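(* There exists a topological groupoid $G$ whose topology is second countable, locally compact and Hausdorff, such that $G$ is transitive and principal, but the range map $r: G \to G^{(0)}$ is not open (and hence the domain map $d: G\to G^{(0)}$ is not open), where $G^{(0)}$ carries the subspace topology induced from $G$.
   Context: For a groupoid $G$, $G^{(2)}$ denotes the set of composable pairs, $G^{(0)}\subset G$ the unit space, $r(x)=xx^{-1}$ the range and $d(x)=x^{-1}x$ the domain of $x\in G$. $G$ is transitive if for all $u,v\in G^{(0)}$ there is $x\in G$ with $r(x)=u$ and $d(x)=v$. $G$ is principal if the map $(r,d):G\to G^{(0)}\times G^{(0)}$, $x\mapsto (r(x),d(x))$, is injective. A topological groupoid is a groupoid $G$ with a topology such that inversion $G\to G$ is continuous and the product map $G^{(2)}\to G$ is continuous, where $G^{(2)}$ has the topology induced from $G\times G$. *)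

(* Defs.v *)
From HB Require Import structures.
From mathcomp Require Import all_boot all_order all_algebra.
From mathcomp Require Import all_classical topology.

Set Implicit Arguments.
Unset Strict Implicit.
Unset Printing Implicit Defensive.

Local Open Scope classical_set_scope.

(* The partial product G^(2) -> G is represented by a total function [gmul];
   its values outside [gcomposable] = G^(2) are junk and are never constrained.
   The axioms are those of Hahn and Renault; they imply that (x, y) is
   composable if and only if x^-1 x = y y^-1. *)
HB.mixin Record isGroupoid (G : Type) := {
  gcomposable : set (G * G);
  gmul : G -> G -> G;
  ginv : G -> G;
  ginvK : forall x, ginv (ginv x) = x;
  gcomposable_mull : forall x y z,
    gcomposable (x, y) -> gcomposable (y, z) -> gcomposable (gmul x y, z);
  gcomposable_mulr : forall x y z,
    gcomposable (x, y) -> gcomposable (y, z) -> gcomposable (x, gmul y z);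
  gmulA : forall x y z, gcomposable (x, y) -> gcomposable (y, z) ->
    gmul (gmul x y) z = gmul x (gmul y z);
  gcomposableVg : forall x, gcomposable (ginv x, x);
  gcomposablegV : forall x, gcomposable (x, ginv x);
  gmulKg : forall x y, gcomposable (x, y) -> gmul (ginv x) (gmul x y) = y;
  gmulgK : forall z x, gcomposable (z, x) -> gmul (gmul z x) (ginv x) = z
}.

#[short(type="groupoidType")]
HB.structure Definition Groupoid := {G of isGroupoid G}.

(* [{within A, continuous f}] is continuity of the restriction of f to A for
   the topology induced on A, here from the product topology of G * G. *)
HB.mixin Record isTopologicalGroupoid G & Topological G & Groupoid G := {
  ginv_continuous : continuous (ginv : G -> G);
  gmul_continuous :
    {within (gcomposable : set (G * G)),
      continuous (fun p : G * G => gmul p.1 p.2)}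
}.

#[short(type="topologicalGroupoidType")]
HB.structure Definition TopologicalGroupoid :=
  {G of Topological G & Groupoid G & isTopologicalGroupoid G}.

Definition unit_space (G : groupoidType) : set G :=
  [set gmul x (ginv x) | x in [set: G]].
Arguments unit_space : clear implicits.

Lemma mul_ginv_unit (G : groupoidType) (x : G) :
  gmul x (ginv x) \in unit_space G.
Proof. by apply/mem_set; exists x. Qed.

Lemma ginv_mul_unit (G : groupoidType) (x : G) :
  gmul (ginv x) x \in unit_space G.
Proof. by apply/mem_set; exists (ginv x) => //; rewrite ginvK. Qed.

(* [unit_space G] used as a type is the subtype of G; when G is topological,
   the library gives it the topology induced from G. *)
Definition range_map (G : groupoidType) (x : G) : unit_space G :=
  SigSub (mul_ginv_unit x).
Arguments range_map {G} x.

Definition domain_map (G : groupoidType) (x : G) : unit_space G :=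
  SigSub (ginv_mul_unit x).
Arguments domain_map {G} x.

Definition transitive_groupoid (G : groupoidType) :=
  forall u v : unit_space G, exists x : G, range_map x = u /\ domain_map x = v.

Definition principal_groupoid (G : groupoidType) :=
  injective (fun x : G => (range_map x, domain_map x)).

Definition open_map (X Y : topologicalType) (f : X -> Y) :=
  forall U : set X, open U -> open (f @` U).

(* Main.v *)
Require Import Defs.
From HB Require Import structures.
From mathcomp Require Import all_boot all_order all_algebra.
From mathcomp Require Import all_classical topology.

Local Open Scope classical_set_scope.

(** Let [X] be the one-point compactification of the natural numbers, and let
    [G] be the pair groupoid of [X], with the topology in which the diagonal is
    clopen and homeomorphic to [X] and every other point is isolated. A product
    near [(oo, oo)] involves two diagonal pairs, so the operations are
    continuous. The pair [(oo, n)] is isolated in [G], but its range [oo] is not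
    isolated in [X], so the range map is not open. *)

(* [None] is the point at infinity; the fresh name keeps the pairs from inheriting
   a product topology. *)
Definition pair_oo : Type := (option nat * option nat)%type.

HB.instance Definition _ := Countable.on pair_oo.

Definition oo : pair_oo := (None, None).
Definition diag (n : nat) : pair_oo := (Some n, Some n).

Definition basic_nbhs (x : pair_oo) (N : nat) : set pair_oo :=
  [set y | y = x \/ x = oo /\ exists2 n, (N <= n)%N & y = diag n].

Lemma basic_nbhs_refl x N : basic_nbhs x N x.
Proof. by left. Qed.

Lemma basic_nbhsS x M N :
  (M <= N)%N -> basic_nbhs x N `<=` basic_nbhs x M.
Proof.
move=> MN y [->|[-> [n Nn ->]]]; first by left.
by right; split=> //; exists n => //; exact: leq_trans Nn.
Qed.

Lemma basic_nbhs_isolated x N : x <> oo -> basic_nbhs x N = [set x].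
Proof.
move=> xoo; apply/seteqP; split=> [y [//|[]//]|_ ->].
exact: basic_nbhs_refl.
Qed.

HB.instance Definition _ := hasNbhs.Build pair_oo
  (fun x => filter_from [set: nat] (basic_nbhs x)).

Lemma nbhs_basic x N y : basic_nbhs x N y -> nbhs y (basic_nbhs x N).
Proof.
move=> [->|[-> [n Nn ->]]]; first by exists N.
(* Here [y] is some [diag n], which is isolated, so any index will do. *)
exists 0 => //; rewrite basic_nbhs_isolated// => _ ->.
by right; split=> //; exists n.
Qed.

Lemma nbhs_pair_oo_filter (x : pair_oo) : ProperFilter (nbhs x).
Proof.
apply: filter_from_proper => [|N _]; last by exists x; exact: basic_nbhs_refl.
apply: filter_from_filter; first by exists 0.
move=> M N _ _; exists (maxn M N) => // y xy.
by split; apply: basic_nbhsS xy; rewrite ?leq_maxl ?leq_maxr.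
Qed.

Lemma nbhs_pair_oo_singleton (x : pair_oo) A : nbhs x A -> A x.
Proof. by move=> [N _]; apply; exact: basic_nbhs_refl. Qed.

Lemma nbhs_pair_oo_nbhs (x : pair_oo) A : nbhs x A -> nbhs x (nbhs^~ A).
Proof.
move=> [N _ NA]; exists N => // y /nbhs_basic[M _ My].
by exists M => // z /My /NA.
Qed.

HB.instance Definition _ := Nbhs_isNbhsTopological.Build pair_oo
  nbhs_pair_oo_filter nbhs_pair_oo_singleton nbhs_pair_oo_nbhs.

Lemma open_basic x N : open (basic_nbhs x N).
Proof. by rewrite openE => y /nbhs_basic. Qed.

Lemma second_countable_pair_oo : @second_countable pair_oo.
Proof.
exists (range (fun xN : pair_oo * nat => basic_nbhs xN.1 xN.2)).
  exact: card_le_trans (card_image_le _ _) (countableP _).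
split=> [_ [[x N] _ <-]|x A [N _ NA]]; first exact: open_basic.
exists (basic_nbhs x N) => //; split; last exact: basic_nbhs_refl.
by exists (x, N).
Qed.

(** Chosen so that the tail of the diagonal from this index on misses [x]; the default 0 is safe
    because no [diag n] has first coordinate [None]. *)
Definition separating_index (x : pair_oo) : nat :=
  if x.1 is Some n then n.+1 else 0.

Lemma basic_nbhs_disjoint x y z : basic_nbhs x (separating_index y) z ->
  basic_nbhs y (separating_index x) z -> x = y.
Proof.
move=> [->|[-> [n ltn ->]]] [//|[-> [m ltm]]] //.
- by move=> xE; move: ltm; rewrite xE /= ltnn.
- by move=> yE; move: ltn; rewrite -yE /= ltnn.
Qed.

Lemma hausdorff_pair_oo : hausdorff_space pair_oo.
Proof.
move=> x y /(_ (basic_nbhs x (separating_index y))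
               (basic_nbhs y (separating_index x))).
case=> [||z [xz yz]].
- exact/nbhs_basic/basic_nbhs_refl.
- exact/nbhs_basic/basic_nbhs_refl.
- exact: basic_nbhs_disjoint xz yz.
Qed.

(** Only [x = oo] needs work: a proper filter that does not cluster at [oo] contains a set disjoint
    from some [basic_nbhs oo M], so it lives on the finitely many [diag n] with [n < M], and finite
    sets are compact. *)
Lemma compact_basic_nbhs x N : compact (basic_nbhs x N).
Proof.
have [->|/eqP xoo] := eqVneq x oo; last first.
  by rewrite basic_nbhs_isolated//; exact: compact_set1.
move=> F PF FN.
have [Foo|/existsNP[A /existsNP[B]]] := pselect (cluster F oo).
  by exists oo; split=> //; exact: basic_nbhs_refl.
move=> /not_implyP[FA /not_implyP[[M _ MB] AB]].
have cK : compact (basic_nbhs oo N `&` diag @` `I_M).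
  exact/finite_compact/finite_setIr/finite_image/finite_II.
have [|y [[Ny _] Fy]] := cK F PF; last by exists y.
apply: filterS (filterI FA FN) => z [Az Nz]; split=> //.
case: Nz => [zoo|[_ [n Nn zn]]].
  by case: AB; exists z; split=> //; apply: MB; left.
have [nM|Mn] := ltnP n M; first by exists n.
by case: AB; exists z; split=> //; apply: MB; right; split=> //; exists n.
Qed.

Lemma locally_compact_pair_oo : locally_compact [set: pair_oo].
Proof.
move=> x _; exists (basic_nbhs x 0).
  by apply: (@filterS _ (nbhs x) _ (basic_nbhs x 0)) => //; exists 0.
split; first exact: compact_basic_nbhs.
exact: compact_closed hausdorff_pair_oo (compact_basic_nbhs _ _).
Qed.

Definition pair_composable : set (pair_oo * pair_oo) :=
  [set xy | xy.1.2 = xy.2.1].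
Definition pair_mul (x y : pair_oo) : pair_oo := (x.1, y.2).
Definition pair_inv (x : pair_oo) : pair_oo := (x.2, x.1).

Lemma pair_invK x : pair_inv (pair_inv x) = x.
Proof. by case: x. Qed.

Lemma pair_mulKV x y :
  pair_composable (x, y) -> pair_mul (pair_inv x) (pair_mul x y) = y.
Proof. by case: x y => [a b] [c d]; rewrite /pair_composable /= => ->. Qed.

Lemma pair_mulVK x y :
  pair_composable (x, y) -> pair_mul (pair_mul x y) (pair_inv y) = x.
Proof. by case: x y => [a b] [c d]; rewrite /pair_composable /= => <-. Qed.

HB.instance Definition _ := @isGroupoid.Build pair_oo
  pair_composable pair_mul pair_inv pair_invK
  (fun _ _ _ _ yz => yz) (fun _ _ _ xy _ => xy) (fun _ _ _ _ _ => erefl)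
  (fun _ => erefl) (fun _ => erefl) pair_mulKV pair_mulVK.

(** Inversion fixes [oo] and every [diag n], so the same [N] serves on both sides. *)
Lemma pair_inv_continuous : continuous (pair_inv : pair_oo -> pair_oo).
Proof.
move=> x A [N _ NA]; exists N => // y [->|[xoo [n Nn ->]]]; apply: NA.
  by left.
by right; rewrite xoo; split=> //; exists n.
Qed.

(** If only one factor moves off its centre, composability of both pairs would give [None = Some n].
    If both move, it forces the same [diag n] twice, and the product is [diag n] again. *)
Lemma pair_mul_basic x y u v N :
  pair_composable (x, y) -> pair_composable (u, v) ->
  basic_nbhs x N u -> basic_nbhs y N v ->
  basic_nbhs (pair_mul x y) N (pair_mul u v).
Proof.
rewrite /pair_composable /= => xy uv [ux|[xoo [n Nn un]]] [vy|[yoo [m Nm vm]]].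
- by rewrite ux vy; left.
- by move: uv; rewrite ux vm xy yoo.
- by move: uv; rewrite un vy -xy xoo.
- move: uv; rewrite un vm xoo yoo => -[<-].
  by right; split=> //; exists n.
Qed.

Lemma pair_mul_continuous : {within pair_composable,
  continuous (fun p : pair_oo * pair_oo => pair_mul p.1 p.2)}.
Proof.
apply/subspace_continuousP => -[x y] xy A [N _ NA].
exists (basic_nbhs x N, basic_nbhs y N); first by split; exists N.
by move=> [u v] [/= xu yv] uv; exact/NA/pair_mul_basic.
Qed.

HB.instance Definition _ :=
  @isTopologicalGroupoid.Build pair_oo pair_inv_continuous pair_mul_continuous.

Lemma transitive_pair_oo : transitive_groupoid pair_oo.
Proof.
move=> [u Pu] [v Pv].
have [x _ xu] := set_mem Pu; have [y _ yv] := set_mem Pv.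
(* Units are the pairs [(a, a)]: here [u] is [(x.1, x.1)] and [v] is [(y.1, y.1)]. *)
by exists (x.1, y.1); split; apply: val_inj; rewrite /= -?xu -?yv.
Qed.

Lemma principal_pair_oo : principal_groupoid pair_oo.
Proof. by move=> [a b] [c d] [-> _ -> _]. Qed.

(** Serves both range and domain: the open set [[set x]] has as image the singleton of the unit
    [oo], yet every open set around [oo] contains some [diag N], which is another unit. *)
Lemma not_open_map_unit_space (f : pair_oo -> unit_space pair_oo) x :
  x <> oo -> val (f x) = oo -> ~ open_map f.
Proof.
move=> xoo fx /(_ _ (open_basic x 0)); rewrite basic_nbhs_isolated//.
rewrite image_set1 => -[W oW Wfx].
have : W oo by rewrite -fx; have : [set f x] (f x) by []; rewrite -Wfx.
move: oW; rewrite openE => oW /oW[N _ NW].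
have Pn : diag N \in unit_space pair_oo by apply/mem_set; exists (diag N).
have : (set_val @^-1` W) (SigSub Pn).
  by apply: NW; right; split=> //; exists N.
by rewrite Wfx => /(congr1 val); rewrite fx.
Qed.

Theorem mainTheorem1 :
  exists G : topologicalGroupoidType,
    [/\ @second_countable G, locally_compact [set: G] & hausdorff_space G] /\
    transitive_groupoid G /\ principal_groupoid G /\
    ~ open_map (range_map : G -> unit_space G) /\
    ~ open_map (domain_map : G -> unit_space G).
Proof.
exists pair_oo; split.
  split; [exact: second_countable_pair_oo|exact: locally_compact_pair_oo|].
  exact: hausdorff_pair_oo.
split; first exact: transitive_pair_oo.
split; first exact: principal_pair_oo.
split.
(* An off-diagonal element with range [oo]; its inverse, with domain [oo], settles the other
   case. *)
- exact: (@not_open_map_unit_space _ (None, Some 0)).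
- exact: (@not_open_map_unit_space _ (Some 0, None)).
Qed.
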